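(* Let $v$ be a Llull matrix on a finite set $A$ with at least two elements, and let $r_x$ and $\varphi_x$ ($x\in A$) be the associated rank-like and fraction-like rates. Then for all $x,y\in A$: (a) $\varphi_x>\varphi_y$ implies $r_x<r_y$; (b) $r_x<r_y$ implies that either $\varphi_x>\varphi_y$ or $\varphi_x=\varphi_y=0$.
   Context: Let $A$ be a finite set with $N\ge2$ elements and $\Pi$ the set of ordered pairs $xy$ with $x,y\in A$, $x\ne y$. A relation on $A$ is a subset of $\Pi$. A Llull matrix on $A$ is a family $v=(v_{xy})_{xy\in\Pi}$ with $v_{xy}\in[0,1]$ and $v_{xy}+v_{yx}\le1$. Turnovers: $t_{xy}=v_{xy}+v_{yx}$. Indirect scores: $v^*_{xy}=\max\min_{0\le i<n}v_{x_ix_{i+1}}$, the max being over all paths $x_0x_1\dots x_n$ ($n\ge1$, consecutive elements distinct) with $x_0=x$, $x_n=y$. Put $m^\nu_{xy}=v^*_{xy}-v^*_{yx}$, $\nu=\{xy\in\Pi: m^\nu_{xy}>0\}$, $\hat\nu=\{xy\in\Pi: m^\nu_{xy}\ge0\}$. An admissible order is a (strict) total order $\xi\subseteq\Pi$ with $\nu\subseteq\xi\subseteq\hat\nu$; one always exists. Write $x\succ y$ for $xy\in\xi$, $x\succeq y$ for $x\succ y$ or $x=y$, and $x'$ for the immediate successor of $x$ in $\xi$ (for $x$ not last). Given an admissible order $\xi$, the projected scores are obtained as follows. (i) For $x\succ y$: $m^\sigma_{xy}=\min\{m^\nu_{pq}: p\succeq x,\ y\succeq q\}$. (ii) $(t^\sigma_{xy})_{xy\in\Pi}$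 is the unique minimizer of $\sum_{xy\in\Pi}(\tau_{xy}-t_{xy})^2$ among all real families $(\tau_{xy})_{xy\in\Pi}$ such that $\tau_{xy}=\tau_{yx}$ for all $xy$; $m^\sigma_{xx'}\le\tau_{xx'}\le1$ for all non-last $x$; $0\le\tau_{xy}-\tau_{xy'}\le m^\sigma_{yy'}$ for all non-last $y$ and all $x\notin\{y,y'\}$. (iii) $\gamma_{xx'}=[(t^\sigma_{xx'}-m^\sigma_{xx'})/2,\ (t^\sigma_{xx'}+m^\sigma_{xx'})/2]$, and for $x\succ y$, $\gamma_{xy}=\bigcup\{\gamma_{pp'}: x\succeq p\succ y\}$, which is a closed interval. (iv) For $x\succ y$: $v^\pi_{xy}=\max\gamma_{xy}$, $v^\pi_{yx}=\min\gamma_{xy}$. The projected scores do not depend on the choice of $\xi$. Put $t^\pi_{xy}=v^\pi_{xy}+v^\pi_{yx}$. Rank-like rates: $r_x=N-\sum_{y\ne x}v^\pi_{xy}$. Fraction-like rates, for a given $f$ (the fraction of non-empty votes; $0<f\le1$ if $v\ne0$ and $f=0$ if $v=0$): if $v=0$, $\varphi_x=0$ for all $x$. If $v\neq0$ (so $(v^\pi_{xy})\ne0$): there is a unique nonempty set $X\subseteq A$ (the top dominant irreducible component of $(v^\pi_{xy})$) such that any two distinct elements of $X$ can be joined in both directions by paths along which $v^\pi>0$, every $y\notin X$ can be reached from every $x\in X$ by such a path, and no $x\in X$ can be reached by such a path from any $y\notin X$. Then $\varphi_x=0$ for $x\notin X$, and $(\varphi_x)_{x\in X}$ is the unique family of positive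 numbers with $\sum_{x\in X}\varphi_x=f$ and $\sum_{y\in X,\,y\ne x}t^\pi_{xy}\,\varphi_x/(\varphi_x+\varphi_y)=\sum_{y\in X,\,y\neq x}v^\pi_{xy}$ for all $x\in X$; equivalently, it is the maximizer of $\prod_{\{x,y\}\subseteq X}\varphi_x^{v^\pi_{xy}}\varphi_y^{v^\pi_{yx}}/(\varphi_x+\varphi_y)^{t^\pi_{xy}}$ among positive families with sum $f$. *)

(* Defs.v *)
From HB Require Import structures.
From mathcomp Require Import all_boot all_order all_algebra.
From mathcomp Require Import classical_sets reals.

Set Implicit Arguments.
Unset Strict Implicit.
Unset Printing Implicit Defensive.

Import Order.TTheory GRing.Theory Num.Theory.
Local Open Scope ring_scope.

(* A family indexed by the ordered pairs of distinct elements of A is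
   represented by a function A -> A -> R; no definition below depends on its
   diagonal values. *)

Section LlullMatrices.
Variables (R : realType) (A : finType).
Implicit Types (v w m t tau vs vpi msigma tsigma : A -> A -> R) (xi : rel A).

Definition is_max (S : set R) (a : R) : Prop := S a /\ ubound S a.
Definition is_min (S : set R) (a : R) : Prop := S a /\ lbound S a.

Definition llull_matrix v : Prop :=
  forall x y : A, x != y -> 0 <= v x y <= 1 /\ v x y + v y x <= 1.

Definition null_family v : Prop := forall x y : A, x != y -> v x y = 0.

Definition turnover v (x y : A) : R := v x y + v y x.

Definition margin v (x y : A) : R := v x y - v y x.

(* The minimum of v over the edges of the path x :: y :: s. *)
Fixpoint path_score v (x y : A) (s : seq A) : R :=
  if s is z :: s' then Num.min (v x y) (path_score v y z s') else v x y.

Definition path_scores v (x y : A) : set R :=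
  [set a | exists x1 s, [/\ path (fun p q => p != q) x (x1 :: s),
                            last x (x1 :: s) = y & a = path_score v x x1 s]]%classic.

Definition indirect_scores v vs : Prop :=
  forall x y : A, x != y -> is_max (path_scores v x y) (vs x y).

Definition strict_total_order xi : Prop :=
  [/\ irreflexive xi, transitive xi
    & forall x y : A, x != y -> xi x y || xi y x].

(* Admissibility with respect to the indirect margins m. *)
Definition admissible_order m xi : Prop :=
  [/\ strict_total_order xi,
      (forall x y : A, x != y -> 0 < m x y -> xi x y)
    & (forall x y : A, xi x y -> 0 <= m x y)].

Definition weakly_above xi (x y : A) : bool := (x == y) || xi x y.

Definition immediate_succ xi (x x' : A) : bool :=
  xi x x' && [forall z, ~~ (xi x z && xi z x')].

(* Meaningful when xi x y, the pairs (p, q) in the range then being distinct;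
   the default value m x y is the term (p, q) = (x, y) of the range. *)
Definition projected_margin m xi (x y : A) : R :=
  \big[Num.min/m x y]_(pq : A * A |
      weakly_above xi pq.1 x && weakly_above xi y pq.2) m pq.1 pq.2.

Definition feasible_turnovers msigma xi tau : Prop :=
  [/\ (forall x y : A, x != y -> tau x y = tau y x),
      (forall x x' : A, immediate_succ xi x x' ->
         msigma x x' <= tau x x' <= 1)
    & (forall x y y' : A, immediate_succ xi y y' -> x != y -> x != y' ->
         0 <= tau x y - tau x y' <= msigma y y')].

Definition sq_distance tau t : R :=
  \sum_(x : A) \sum_(y : A | y != x) (tau x y - t x y) ^+ 2.

Definition projected_turnovers t msigma xi tsigma : Prop :=
  feasible_turnovers msigma xi tsigma /\
  forall tau, feasible_turnovers msigma xi tau ->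
    sq_distance tsigma t <= sq_distance tau t.

Definition gamma_succ msigma tsigma (x x' : A) : set R :=
  [set a | (tsigma x x' - msigma x x') / 2 <= a
           <= (tsigma x x' + msigma x x') / 2]%classic.

Definition gamma msigma tsigma xi (x y : A) : set R :=
  [set a | exists p p', [/\ weakly_above xi x p, xi p y,
      immediate_succ xi p p' & gamma_succ msigma tsigma p p' a]]%classic.

Definition projected_scores_for v xi vpi : Prop :=
  exists vs tsigma,
    let msigma := projected_margin (margin vs) xi in
    [/\ indirect_scores v vs,
        admissible_order (margin vs) xi,
        projected_turnovers (turnover v) msigma xi tsigma
      & forall x y : A, xi x y ->
          is_max (gamma msigma tsigma xi x y) (vpi x y) /\
          is_min (gamma msigma tsigma xi x y) (vpi y x)].

Definition projected_scores v vpi : Prop :=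
  exists xi, projected_scores_for v xi vpi.

Definition rank_rate vpi (x : A) : R :=
  #|A|%:R - \sum_(y : A | y != x) vpi x y.

(* For x != y, joined_by w x y says that some path from x to y has positive
   scores w along all its edges. *)
Definition joined_by w : rel A := connect (fun x y => (x != y) && (0 < w x y)).

Definition top_dominant_component w (X : {set A}) : Prop :=
  [/\ (exists x, x \in X),
      (forall x y : A, x \in X -> y \in X -> x != y -> joined_by w x y),
      (forall x y : A, x \in X -> y \notin X -> joined_by w x y)
    & (forall x y : A, x \in X -> y \notin X -> ~~ joined_by w y x)].

Definition vote_fraction v (f : R) : Prop :=
  (null_family v -> f = 0) /\ (~ null_family v -> 0 < f <= 1).

Definition fraction_rates v vpi (f : R) (phi : A -> R) : Prop :=
  (null_family v -> forall x, phi x = 0) /\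
  (~ null_family v -> exists X : {set A},
     [/\ top_dominant_component vpi X,
         (forall x, x \notin X -> phi x = 0),
         (forall x, x \in X -> 0 < phi x),
         \sum_(x in X) phi x = f
       & forall x, x \in X ->
           \sum_(y in X | y != x) turnover vpi x y * (phi x / (phi x + phi y))
           = \sum_(y in X | y != x) vpi x y]).

End LlullMatrices.

(* Main.v *)
Require Import Defs.
From mathcomp Require Import all_boot all_order all_algebra.
From mathcomp Require Import boolp classical_sets reals.
From mathcomp Require Import ring lra.
Set Implicit Arguments.
Unset Strict Implicit.
Unset Printing Implicit Defensive.

Import Order.TTheory GRing.Theory Num.Theory.
Local Open Scope ring_scope.

(** Along an admissible order the sets [gamma x y] are concatenated,
    [gamma x z = gamma x y `|` gamma y z], and the two pieces overlap because the
    turnover constraints bound the gap between the centres of consecutive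
    intervals by the sum of their radii.  Hence a higher candidate dominates a
    lower one: it does at least as well against every third candidate, both in
    its row and in its column; and if it merely ties with the lower one, then
    [gamma x y] is a point and the domination goes both ways.  Row sums then
    compare the ranks.  For the fractions, the equation at [x] says that the
    excesses [(w z x * phi x - w x z * phi z) / (phi x + phi z)] sum to [0] over
    [z] in the top component; they increase with [phi x] and, at equal fractions,
    are smaller for a dominating candidate, which therefore cannot have the
    smaller fraction, equal positive fractions forcing a tie. *)

(** * Neighbours in a finite strict total order *)

Section FiniteTotalOrder.
Variables (A : finType) (xi : rel A).
Hypothesis hxi : strict_total_order xi.

Lemma above_trans y x z : xi x y -> xi y z -> xi x z.
Proof. by case: hxi => _ tr _; apply: tr. Qed.

Lemma weakly_above_trans y x z :
  weakly_above xi x y -> weakly_above xi y z -> weakly_above xi x z.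
Proof.
rewrite /weakly_above => /orP[/eqP->//|xy] /orP[/eqP<-|yz]; first by rewrite xy orbT.
by rewrite (above_trans xy yz) orbT.
Qed.

Lemma above_weakly x y : xi x y -> weakly_above xi x y.
Proof. by rewrite /weakly_above orbC => ->. Qed.

Lemma weakly_above_refl x : weakly_above xi x x.
Proof. by rewrite /weakly_above eqxx. Qed.

Lemma above_neq x y : xi x y -> x != y.
Proof. by case: hxi => irr _ _ xy; apply/eqP => e; rewrite e irr in xy. Qed.

Lemma weakly_above_total x y : xi x y \/ weakly_above xi y x.
Proof.
case: hxi => _ _ tot; have [->|xy] := eqVneq x y.
  by right; apply: weakly_above_refl.
by case/orP: (tot _ _ xy) => ?; [left | right; apply: above_weakly].
Qed.

(** Induction on the number of elements strictly between the two: any such element can replace [z]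
    and leaves fewer. *)
Lemma successor_exists x z :
  xi x z -> exists2 y, immediate_succ xi x y & weakly_above xi y z.
Proof.
have [n] := ubnP #|[pred w | xi x w && xi w z]|; elim: n z => // n IHn z ltn xz.
case: (boolP [forall w, ~~ (xi x w && xi w z)]) => [none|].
  by exists z; [rewrite /immediate_succ xz | apply: weakly_above_refl].
case/forallPn => w /negPn /andP[xw wz].
have [|y xy yw] := IHn w _ xw; last first.
  by exists y => //; apply: weakly_above_trans yw (above_weakly wz).
apply: leq_trans (proper_card _) ltn; apply/properP; split.
  by apply/fintype.subsetP => u; rewrite !inE => /andP[-> uw]; apply: above_trans uw wz.
by exists w; rewrite !inE ?xw ?wz //=; case: hxi => ->.
Qed.

Lemma predecessor_exists x z :
  xi x z -> exists2 y, weakly_above xi x y & immediate_succ xi y z.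
Proof.
have [n] := ubnP #|[pred w | xi x w && xi w z]|; elim: n x => // n IHn x ltn xz.
case: (boolP [forall w, ~~ (xi x w && xi w z)]) => [none|].
  by exists x; [apply: weakly_above_refl | rewrite /immediate_succ xz].
case/forallPn => w /negPn /andP[xw wz].
have [|y wy yz] := IHn w _ wz; last first.
  by exists y => //; apply: weakly_above_trans (above_weakly xw) wy.
apply: leq_trans (proper_card _) ltn; apply/properP; split.
  by apply/fintype.subsetP => u; rewrite !inE => /andP[wu ->]; rewrite (above_trans xw wu).
by exists w; rewrite !inE ?xw ?wz //=; case: hxi => ->.
Qed.

End FiniteTotalOrder.

(** The mutual scores are compared separately, since the diagonal of [w] carries no meaning. *)
Definition dominates {R : realType} {A : finType} (w : A -> A -> R) (x y : A) : Prop :=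
  w y x <= w x y /\
  forall z, z != x -> z != y -> w y z <= w x z /\ w z x <= w z y.

(** * Unions of intervals along the order *)

Section ProjectedScores.
Variables (R : realType) (A : finType) (xi : rel A) (m tau w : A -> A -> R).
Hypothesis hxi : strict_total_order xi.
Hypothesis htau : feasible_turnovers m xi tau.
Hypothesis hw : forall x y : A, xi x y ->
  is_max (gamma m tau xi x y) (w x y) /\
  is_min (gamma m tau xi x y) (w y x).

Local Notation G := (gamma m tau xi).

Lemma gamma_ge0 x y a : G x y a -> 0 <= a.
Proof.
case: htau => _ hs _ [p [p' [_ _ pp' /= /andP[]]]].
by have /andP[] := hs _ _ pp'; lra.
Qed.

Lemma gamma_cat x y z : xi x y -> xi y z -> G x z = (G x y `|` G y z)%classic.
Proof.
move=> xy yz; apply/seteqP; split=> a.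
- move=> [p [p' [xp pz pp' ap]]].
  case: (weakly_above_total hxi p y) => [py|yp].
    by left; exists p, p'.
  by right; exists p, p'.
- move=> [|] [p [p' [xp pz pp' ap]]]; exists p, p'; split=> //.
    exact: (above_trans hxi pz yz).
  exact: (weakly_above_trans hxi (above_weakly xy) xp).
Qed.

Lemma gamma_overlap x y z : xi x y -> xi y z -> exists a, G x y a /\ G y z a.
Proof.
move=> xy yz.
have [p xp py] := predecessor_exists hxi xy.
have [y' yy' y'z] := successor_exists hxi yz.
have /andP[pylt _] := py; have /andP[yylt _] := yy'.
have pyn := above_neq hxi pylt.
have yyn := above_neq hxi yylt.
have pyn' := above_neq hxi (above_trans hxi pylt yylt).
case: htau => sym _ gap.
(* With the symmetry of [tau], the two constraints give [0 <= tau p y - tau y y' <= m p y + m y y']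
   and nonnegative radii, so the larger lower end lies below both upper ends. *)
have /andP[g1 g2] := gap _ _ _ yy' pyn pyn'.
have := gap y' _ _ py; rewrite eq_sym pyn' eq_sym yyn => /(_ isT isT) /andP[].
rewrite (sym y' p) 1?eq_sym // (sym y' y) 1?eq_sym // => g3 g4.
pose lo (s s' : A) : R := (tau s s' - m s s') / 2.
exists (Num.max (lo p y) (lo y y')); split.
- exists p, y; split=> //; apply/andP; split; first by rewrite le_max lexx.
  by rewrite ge_max /lo; apply/andP; split; lra.
- exists y, y'; split=> //; first exact: weakly_above_refl.
  apply/andP; split; first by rewrite le_max lexx orbT.
  by rewrite ge_max /lo; apply/andP; split; lra.
Qed.

Lemma gamma_le x y a : xi x y -> G x y a -> w y x <= a <= w x y.
Proof.
by move=> xy ga; have [[_ ub] [_ lb]] := hw xy; rewrite ub // lb.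
Qed.

Lemma max_gamma x y : xi x y -> G x y (w x y).
Proof. by move=> /hw[[]]. Qed.

Lemma min_gamma x y : xi x y -> G x y (w y x).
Proof. by move=> /hw[_ []]. Qed.

Lemma gamma_scores_sub x y x1 y1 : xi x y -> xi x1 y1 ->
  (G x1 y1 `<=` G x y)%classic -> w x1 y1 <= w x y /\ w y x <= w y1 x1.
Proof.
move=> xy xy1 sub; split.
  by have /andP[] := gamma_le xy (sub _ (max_gamma xy1)).
by have /andP[] := gamma_le xy (sub _ (min_gamma xy1)).
Qed.

(** If [z] lies outside the segment from [x] to [y], one set contains the other; if it lies between,
    a common point [a] of the two sets separates the scores to be compared. *)
Lemma above_dominates x y : xi x y -> dominates w x y.
Proof.
move=> xy; split=> [|z zx zy].
  by have /andP[] := gamma_le xy (max_gamma xy).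
case: (weakly_above_total hxi z x) => [lzx|/orP[/eqP e|xz]].
- have [] := gamma_scores_sub (above_trans hxi lzx xy) lzx => //.
  by rewrite (@gamma_cat z x y) //; left.
- by rewrite e eqxx in zx.
case: (weakly_above_total hxi z y) => [lzy|/orP[/eqP e|yz]].
- have [a [a1 a2]] := gamma_overlap xz lzy.
  have /andP[p1 p2] := gamma_le xz a1.
  have /andP[p3 p4] := gamma_le lzy a2.
  by split; [apply: le_trans p3 p2 | apply: le_trans p1 p4].
- by rewrite e eqxx in zy.
have [] := gamma_scores_sub xz yz => //.
by rewrite (@gamma_cat x y z) //; right.
Qed.

Lemma above_tie x y : xi x y -> w x y = w y x -> dominates w y x.
Proof.
move=> xy tie.
have point a : G x y a -> a = w x y.
  by move=> /(gamma_le xy); rewrite -tie -eq_le => /eqP.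
split=> [|z zy zx]; first by rewrite tie.
case: (weakly_above_total hxi z x) => [lzx|/orP[/eqP e|xz]].
- have [] := gamma_scores_sub lzx (above_trans hxi lzx xy) => //.
  rewrite (@gamma_cat z x y) // => a [//|/point->].
  (* By overlap, the single point of [G x y] already lies in [G z x]. *)
  by have [b [b1 /point<-]] := gamma_overlap lzx xy.
- by rewrite e eqxx in zx.
case: (weakly_above_total hxi z y) => [lzy|/orP[/eqP e|yz]].
- have subl : (G x z `<=` G x y)%classic by rewrite (@gamma_cat x z y) //; left.
  have subr : (G z y `<=` G x y)%classic by rewrite (@gamma_cat x z y) //; right.
  have e1 := point _ (subl _ (max_gamma xz)).
  have e2 := point _ (subl _ (min_gamma xz)).
  have e3 := point _ (subr _ (max_gamma lzy)).
  have e4 := point _ (subr _ (min_gamma lzy)).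
  by rewrite e1 e2 e3 e4.
- by rewrite e eqxx in zy.
have [] := gamma_scores_sub yz xz => //.
rewrite (@gamma_cat x y z) // => a [/point->|//].
by have [b [/point<-]] := gamma_overlap xy yz.
Qed.

End ProjectedScores.

(** * Domination among projected scores *)

Section Dominance.
Variables (R : realType) (A : finType) (v w : A -> A -> R).
Hypothesis hw : projected_scores v w.

Lemma projected_scores_ge0 x y : x != y -> 0 <= w x y.
Proof.
case: hw => xi [vs [tau [_ [so _ _] [ht _] hg]]] xy.
case: (so) => _ _ /(_ _ _ xy) /orP[] /hg [[mx _] [mn _]].
  by have := gamma_ge0 ht mx.
by have := gamma_ge0 ht mn.
Qed.

Lemma projected_scores_dominates x y : x != y -> dominates w x y \/ dominates w y x.
Proof.
case: hw => xi [vs [tau [_ [so _ _] [ht _] hg]]] xy.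
case: (so) => _ _ /(_ _ _ xy) /orP[] l; [left|right];
  refine (above_dominates so ht hg l).
Qed.

Lemma projected_scores_tie x y : x != y -> w x y = w y x -> dominates w x y.
Proof.
case: hw => xi [vs [tau [_ [so _ _] [ht _] hg]]] xy tie.
case: (so) => _ _ /(_ _ _ xy) /orP[] l; first refine (above_dominates so ht hg l).
refine (above_tie so ht hg l (esym tie)).
Qed.

End Dominance.

(** * Rank-like rates under domination *)

Section RankRates.
Variables (R : realType) (A : finType) (w : A -> A -> R).

Lemma rank_rateD1 x y : x != y ->
  rank_rate w x = #|A|%:R - w x y - \sum_(z | (z != x) && (z != y)) w x z.
Proof. by move=> xy; rewrite /rank_rate (bigD1 y) 1?eq_sym //= opprD addrA. Qed.

Lemma dominates_rank_rest x y : x != y -> dominates w x y ->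
  \sum_(z | (z != y) && (z != x)) w y z <= \sum_(z | (z != x) && (z != y)) w x z.
Proof.
move=> xy [_ dom]; under eq_bigl do rewrite andbC.
by apply: ler_sum => z /andP[zx zy]; case: (dom z zx zy).
Qed.

Lemma dominates_rank x y : x != y -> dominates w x y ->
  rank_rate w x <= rank_rate w y.
Proof.
move=> xy dom; rewrite (@rank_rateD1 x y) // (@rank_rateD1 y x) 1?eq_sym //.
by have := dominates_rank_rest xy dom; case: dom => + _; lra.
Qed.

Lemma dominates_rank_lt x y : x != y -> dominates w x y -> w y x < w x y ->
  rank_rate w x < rank_rate w y.
Proof.
move=> xy dom; rewrite (@rank_rateD1 x y) // (@rank_rateD1 y x) 1?eq_sym //.
by have := dominates_rank_rest xy dom; lra.
Qed.

End RankRates.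

(** For a nonzero denominator this is [turnover w x z * (phi x / (phi x + phi z)) - w x z], the
    predicted minus the actual score of [x] against [z]. *)
Definition excess {R : realType} {A : finType} (w : A -> A -> R) (phi : A -> R)
    (x z : A) : R :=
  (w z x * phi x - w x z * phi z) / (phi x + phi z).

(** * Monotonicity of the excess *)

Section ExcessRatio.
Variables (R : realType) (a a' b b' p q s : R).
Hypotheses (a0 : 0 <= a) (aa' : a <= a') (b'0 : 0 <= b') (b'b : b' <= b).
Hypotheses (p0 : 0 < p) (pq : p <= q) (s0 : 0 < s).

(* The left-hand side is the difference of the two ratios times
   [(q + s) * (p + s)]; each summand on the right is nonnegative. *)
Lemma ratio_cross :
  (a' * q - b' * s) * (p + s) - (a * p - b * s) * (q + s) =
  (a' - a) * (p * q) + (a' * q - a * p) * s + (b * q - b' * p) * s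
  + (b - b') * (s * s).
Proof. by ring. Qed.

Let q0 : 0 < q. Proof. exact: lt_le_trans p0 pq. Qed.
Let c1 : 0 <= (a' - a) * (p * q).
Proof. by rewrite mulr_ge0 ?subr_ge0 // mulr_ge0 ?ltW. Qed.
Let c2 : 0 <= (a' * q - a * p) * s.
Proof. by rewrite mulr_ge0 ?(ltW s0) // subr_ge0 ler_pM // ltW. Qed.
Let c3 : 0 <= (b * q - b' * p) * s.
Proof. by rewrite mulr_ge0 ?(ltW s0) // subr_ge0 ler_pM // ltW. Qed.
Let c4 : 0 <= (b - b') * (s * s).
Proof. by rewrite mulr_ge0 ?subr_ge0 // mulr_ge0 ?ltW. Qed.

(** Meant for [x] dominating [y], with [a = w z x], [b = w x z], [p = phi x], then [a'], [b'], [q]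
    likewise for [y], and [s = phi z]. *)
Lemma excess_ratio_le :
  (a * p - b * s) / (p + s) <= (a' * q - b' * s) / (q + s).
Proof.
rewrite ler_pdivrMr ?addr_gt0 // mulrAC ler_pdivlMr ?addr_gt0 //.
by rewrite -subr_ge0 ratio_cross !addr_ge0.
Qed.

(** Equality makes all four summands of [ratio_cross] vanish; the third gives
    [b * q = b' * p <= b * p], impossible for [b > 0] as [p < q]. *)
Lemma excess_ratio_eq : p < q ->
  (a * p - b * s) / (p + s) = (a' * q - b' * s) / (q + s) -> b = 0.
Proof.
have ps : p + s != 0 by rewrite gt_eqF ?addr_gt0.
have qs : q + s != 0 by rewrite gt_eqF ?addr_gt0.
move=> ltpq /eqP; rewrite eqr_div // eq_sym -subr_eq0.
rewrite ratio_cross => /eqP e0.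
have /eqP : (b * q - b' * p) * s = 0 by move: c1 c2 c3 c4 e0; lra.
rewrite mulf_eq0 (gt_eqF s0) orbF subr_eq0 => /eqP e.
have : b * (q - p) <= 0.
  have : b' * p <= b * p by rewrite ler_wpM2r // ltW.
  by rewrite mulrBr e; lra.
rewrite pmulr_lle0 ?subr_gt0 // => ble0.
by apply/eqP; rewrite eq_le ble0 (le_trans b'0 b'b).
Qed.

End ExcessRatio.

(** * The top component and the fraction-like rates *)

Section TopComponent.
Variables (R : realType) (A : finType) (w : A -> A -> R) (X : {set A}).
Hypothesis w_ge0 : forall x y : A, x != y -> 0 <= w x y.
Hypothesis hX : top_dominant_component w X.

Lemma joined_first_edge x y : x != y -> joined_by w x y ->
  exists z, [/\ x != z, 0 < w x z & joined_by w z y].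
Proof.
move=> xy /connectP[[|z s] /=]; first by move=> _ e; rewrite e eqxx in xy.
by move=> /andP[/andP[xz w0] ps] e; exists z; split=> //; apply/connectP; exists s.
Qed.

Lemma joined_last_edge x y : x != y -> joined_by w x y ->
  exists z, z != y /\ 0 < w z y.
Proof.
move=> xy /connectP[s]; elim/last_ind: s => [_ /= e|s z _].
  by rewrite e eqxx in xy.
by rewrite rcons_path last_rcons => /andP[_ /andP[h1 h2]] ->; exists (last x s).
Qed.

Lemma top_no_edge x y : x \in X -> y \notin X -> w y x <= 0.
Proof.
case: hX => _ _ _ nb xX yX; rewrite leNgt; apply: contra (nb _ _ xX yX) => w0.
by apply: connect1; rewrite w0 andbT; apply: contraNneq yX => ->.
Qed.

(** The first edge of a path from [x] to [y] cannot leave [X], as the rest of the path would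
    re-enter it. *)
Lemma top_edge x y : x \in X -> y \in X -> x != y ->
  exists z, [/\ z \in X, z != x & 0 < w x z].
Proof.
case: hX => _ irr _ nb xX yX xy.
have [z [xz w0 zy]] := joined_first_edge xy (irr _ _ xX yX xy).
exists z; rewrite eq_sym; split=> //.
by apply: contraLR zy => zX; apply: nb.
Qed.

(** If [x] were outside [X], domination would leave [y] no positive edge inside [X], so [X] would be
    [{y}]; the last edge of a path from [y] to [x] would start at some [z] outside [X], and
    domination would give [w z y > 0], an edge into [X]. *)
Lemma dominates_top x y : x != y -> dominates w x y -> y \in X -> x \in X.
Proof.
move=> xy [dxy dom] yX; apply/negPn/negP => xX.
have wyx : w y x <= 0 := le_trans dxy (top_no_edge yX xX).
have onlyy z : z \in X -> z = y.
  move=> zX; apply/eqP/negPn/negP => zy.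
  have [u [uX uy]] := top_edge yX zX (contra_neq esym zy).
  have ux : u != x by apply: contraNneq xX => <-.
  have [wu _] := dom u ux uy.
  by apply/negP; rewrite -leNgt (le_trans wu) // top_no_edge.
case: hX => _ _ dn _.
have [|z [zx w0]] := joined_last_edge _ (dn _ _ yX xX); first by rewrite eq_sym.
have [zy|zy] := eqVneq z y; first by rewrite zy ltNge wyx in w0.
have [_ wz] := dom z zx zy.
have zX : z \notin X by apply: contraNN zy => /onlyy ->.
by have := top_no_edge yX zX; move: w0 wz; lra.
Qed.

Variable phi : A -> R.
Hypothesis phi_out : forall x, x \notin X -> phi x = 0.
Hypothesis phi_in : forall x, x \in X -> 0 < phi x.
Hypothesis phi_eq : forall x, x \in X ->
  \sum_(y in X | y != x) turnover w x y * (phi x / (phi x + phi y))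
  = \sum_(y in X | y != x) w x y.

Local Notation F := (excess w phi).

Lemma excess_sum x : x \in X -> \sum_(z in X | z != x) F x z = 0.
Proof.
move=> xX; have /eqP := phi_eq xX; rewrite -subr_eq0 -sumrB => /eqP e.
rewrite -[RHS]e; apply: eq_bigr => z /andP[zX _]; rewrite /turnover /excess.
have xz : phi x + phi z != 0 by rewrite gt_eqF // addr_gt0 ?phi_in.
by field.
Qed.

Lemma excess_opp x y : F y x = - F x y.
Proof. by rewrite /excess [phi y + _]addrC -[RHS]mulNr opprB. Qed.

Lemma dominates_excess_le x y z : x \in X -> y \in X -> z \in X ->
  z != x -> z != y -> dominates w x y -> phi x <= phi y -> F x z <= F y z.
Proof.
move=> xX yX zX zx zy [_ /(_ z zx zy)[d1 d2]] le.
by apply: excess_ratio_le; rewrite ?w_ge0 ?phi_in // eq_sym.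
Qed.

(** Let [Sx], [Sy] be the sums of the excesses over the other [z]. Then [Sx <= Sy], while
    [Sx = - F x y >= 0] and [Sy = F x y <= 0]; so all three vanish and the termwise inequalities are
    equalities. *)
Lemma dominates_excess_eq x y : x \in X -> y \in X -> x != y ->
  dominates w x y -> phi x <= phi y ->
  F x y = 0 /\ forall z, z \in X -> z != x -> z != y -> F x z = F y z.
Proof.
move=> xX yX xy dom le.
have nonpos : F x y <= 0.
  rewrite /excess pmulr_lle0 ?invr_gt0 ?addr_gt0 ?phi_in // subr_le0.
  by case: dom => d _; rewrite ler_pM ?w_ge0 1?eq_sym // ltW ?phi_in.
have leF z : (z \in X) && (z != x) && (z != y) -> F x z <= F y z.
  by move=> /andP[/andP[zX zx] zy]; apply: dominates_excess_le.
have := excess_sum xX; rewrite (bigD1 y) ?yX 1?eq_sym //= => s1.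
have := excess_sum yX; rewrite (bigD1 x) ?xX //= => s2.
have s2E : \sum_(z | (z \in X) && (z != y) && (z != x)) F y z =
           \sum_(z | (z \in X) && (z != x) && (z != y)) F y z.
  by apply: eq_bigl => z; rewrite andbAC.
rewrite s2E excess_opp in s2.
have leS := ler_sum (index_enum A) leF.
have F0 : F x y = 0 by move: leS s1 s2 nonpos; lra.
split=> // z zX zx zy; apply/eqP.
have sd : \sum_(z | (z \in X) && (z != x) && (z != y)) (F y z - F x z) = 0.
  by rewrite sumrB; move: s1 s2; rewrite F0; lra.
have /allP/(_ z (mem_index_enum z)) : all (fun i =>
    ((i \in X) && (i != x) && (i != y)) ==> (F y i - F x i == 0)) (index_enum A).
  by rewrite -psumr_eq0 ?sd // => i hi; rewrite subr_ge0 leF.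
by rewrite zX zx zy /= subr_eq0 eq_sym.
Qed.

Lemma dominates_fraction x y : x != y -> dominates w x y -> phi y <= phi x.
Proof.
move=> xy dom.
have [yX|yX] := boolP (y \in X); last first.
  rewrite (phi_out yX); have [/phi_in/ltW//|/phi_out->//] := boolP (x \in X).
have xX := dominates_top xy dom yX.
rewrite leNgt; apply/negP => lt.
have [F0 FE] := dominates_excess_eq xX yX xy dom (ltW lt).
(* It remains to contradict this positive edge by showing [w x z <= 0]. *)
have [z [zX zx]] := top_edge xX yX xy.
apply/negP; rewrite -leNgt.
have [->|zy] := eqVneq z y; last first.
  case: dom => _ /(_ z zx zy)[d1 d2].
  have yz : y != z by rewrite eq_sym.
  rewrite (excess_ratio_eq _ d2 _ d1 _ (ltW lt) _ lt (FE z zX zx zy));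
    by rewrite ?w_ge0 ?phi_in.
(* For [z = y], [F x y = 0] reads [w y x * phi x = w x y * phi y]; with [w y x <= w x y] and
   [phi x < phi y] this excludes [w x y > 0]. *)
move/eqP: F0; rewrite mulf_eq0 invr_eq0 (gt_eqF (addr_gt0 (phi_in xX) (phi_in yX))) orbF.
rewrite subr_eq0 => /eqP e; rewrite leNgt; apply/negP => w0.
have : w y x * phi x <= w x y * phi x.
  by case: dom => d _; rewrite ler_wpM2r // ltW ?phi_in.
by rewrite e ler_pM2l // leNgt lt.
Qed.

Lemma dominates_fraction_tie x y : x != y -> dominates w x y ->
  phi x = phi y -> phi x != 0 -> w x y = w y x.
Proof.
move=> xy dom e n0.
have xX : x \in X by apply: contraNT n0 => /phi_out ->.
have yX : y \in X by apply: contraNT n0; rewrite e => /phi_out ->.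
have [|/eqP F0 _] := dominates_excess_eq xX yX xy dom; first by rewrite e.
move: F0; rewrite mulf_eq0 invr_eq0 (gt_eqF (addr_gt0 (phi_in xX) (phi_in yX))).
rewrite orbF subr_eq0 e => /eqP /mulIf -> //.
by rewrite -e.
Qed.

End TopComponent.

Theorem theorem12p3 (R : realType) (A : finType) (hA : (2 <= #|A|)%N)
  (v : A -> A -> R) (hv : llull_matrix v)
  (vpi : A -> A -> R) (hpi : projected_scores v vpi)
  (f : R) (hf : vote_fraction v f)
  (phi : A -> R) (hphi : fraction_rates v vpi f phi) :
  forall x y : A,
    (phi x > phi y -> rank_rate vpi x < rank_rate vpi y) /\
    (rank_rate vpi x < rank_rate vpi y ->
       phi x > phi y \/ (phi x = 0 /\ phi y = 0)).
Proof.
move=> x y; case: hphi => phi0 phiX.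
case: (EM (null_family v)) => [/phi0 e|/phiX [X [hX out inn _ eqn]]].
  by rewrite !e ltxx; split=> // _; right.
have w0 := projected_scores_ge0 hpi.
have mono := dominates_fraction w0 hX out inn eqn.
have tieF := dominates_fraction_tie w0 out inn eqn.
have tie := projected_scores_tie hpi.
have [->|xy] := eqVneq x y; first by rewrite !ltxx.
have yx : y != x by rewrite eq_sym.
case: (projected_scores_dominates hpi xy) => dom; split=> lt.
- apply: dominates_rank_lt => //; case: (dom) => d _; rewrite lt_def d andbT.
  (* A tie would make [y] dominate [x] as well, against [phi y < phi x]. *)
  apply/eqP => e; have := mono _ _ yx (tie _ _ yx (esym e)).
  by rewrite leNgt lt.
- have := mono _ _ xy dom; rewrite le_eqVlt => /orP[/eqP e|]; last by left.
  have [z|nz] := eqVneq (phi x) 0; first by right; rewrite e z.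
  (* Equal nonzero fractions force a tie, so [y] dominates [x] too, against the strict rank
     inequality. *)
  have := dominates_rank yx (tie _ _ yx (esym (tieF _ _ xy dom (esym e) nz))).
  by rewrite leNgt lt.
- by have := mono _ _ yx dom; rewrite leNgt lt.
- by have := dominates_rank yx dom; rewrite leNgt lt.
Qed.
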